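(* Let $G$ be a finite simple graph with maximum degree $\Delta$, and let $P_G$ denote its chromatic polynomial. Let $$K^{*} = \min_{1<y<2} \frac{y}{(2-y)\log y} \;(\approx 6.907),$$ and set $C = \sqrt{2}\,K^{*}$. Then for every integer $q \geq C\Delta + 1$, $$P_G(q-1)\,P_G(q+1) \leq P_G(q)^2 .$$
   Context: For a graph $G=(V,E)$ and a positive integer $q$, a $q$-coloring is a map $\alpha: V\to\{1,\dots,q\}$ with $\alpha(u)\neq\alpha(v)$ for every edge $(u,v)\in E$. The chromatic polynomial $P_G$ is the polynomial $P_G(q)=\sum_{E'\subseteq E} (-1)^{|E'|} q^{C(E')}$, where $C(E')$ is the number of connected components of the spanning subgraph $(V,E')$; for positive integers $q$, $P_G(q)$ equals the number of $q$-colorings of $G$. The maximum degree $\Delta$ is the largest vertex degree of $G$. *)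

(* Defs.v *)
From HB Require Import structures.
From mathcomp Require Import all_boot all_order all_algebra.
From mathcomp Require Import all_classical all_reals all_analysis.
From mathcomp Require Import lra.

Set Implicit Arguments.
Unset Strict Implicit.
Unset Printing Implicit Defensive.

Import Order.TTheory GRing.Theory Num.Theory.
Import numFieldNormedType.Exports.

Local Open Scope ring_scope.

(* A finite simple graph is a symmetric irreflexive adjacency relation on a
   finType; its edges are the unordered pairs {x, y} of adjacent vertices. *)
Section Graph.
Variables (T : finType) (adj : rel T).

Definition edges : {set {set T}} :=
  [set A | [exists x, exists y, adj x y && (A == [set x; y])]].

Definition degree (x : T) : nat := #|[set y | adj x y]|.

Definition max_degree : nat := \max_(x : T) degree x.

(* For irreflexive adj and E \subset edges no singleton [set x; x] is in E, so
   this is exactly the adjacency relation of the spanning subgraph (T, E). *)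
Definition spanning_adj (E : {set {set T}}) : rel T :=
  [rel x y | [set x; y] \in E].

Definition num_components (E : {set {set T}}) : nat :=
  n_comp (spanning_adj E) predT.

Definition chromatic_poly : {poly int} :=
  \sum_(E in powerset edges) (-1) ^+ #|E| *: 'X^(num_components E).

End Graph.

Definition Kfun (R : realType) (y : R) : R := y / ((2 - y) * ln y).

(* The infimum is attained, see Kstar_is_min. *)
Definition Kstar (R : realType) : R :=
  inf [set Kfun y | y in [set y : R | 1 < y < 2]]%classic.

Lemma Kfun_ge (R : realType) (y : R) : 1 < y < 2 ->
  1 <= Kfun y * ((2 - y) * (y - 1)).
Proof.
move=> /andP[y1 y2].
have ly : 0 < ln y by rewrite ln_gt0.
have lyle : ln y <= y - 1.
  by rewrite -{1}(subrKC 1 y); apply: le_ln1Dx; lra.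
have p2 : 0 < 2 - y by lra.
have p : 0 < (2 - y) * ln y by rewrite mulr_gt0.
rewrite /Kfun mulrAC ler_pdivlMr // mul1r.
have h1 : (2 - y) * ln y <= (2 - y) * (y - 1) by rewrite ler_pM2l.
have h2 : 0 <= (2 - y) * (y - 1) by rewrite mulr_ge0 //; lra.
nra.
Qed.

Lemma Kfun_cont (R : realType) (y : R) : 1 < y < 2 ->
  {for y, continuous (@Kfun R)}.
Proof.
move=> /andP[y1 y2].
have ly : 0 < ln y by rewrite ln_gt0.
have p2 : 0 < 2 - y by lra.
apply: cvgM; first exact: cvg_id.
apply: cvgV; first by rewrite mulf_neq0 // gt_eqF.
apply: cvgM; first by apply: cvgB; [exact: cvg_cst | exact: cvg_id].
by apply: continuous_ln; lra.
Qed.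

Lemma Kfun_min (R : realType) : exists2 y0 : R, 1 < y0 < 2 &
  forall y, 1 < y < 2 -> Kfun y0 <= Kfun y.
Proof.
pose M := Kfun (3 / 2 : R).
have h32 : 1 < (3 / 2 : R) < 2 by lra.
have M4 : 4 <= M by have := Kfun_ge h32; rewrite -/M; lra.
have Mi : 0 < M^-1 by rewrite invr_gt0; lra.
have MiE : M * M^-1 = 1 by rewrite divff // gt_eqF //; lra.
have Mi4 : M^-1 <= 1 / 4 by nra.
have ab : 1 + M^-1 <= 2 - M^-1 by lra.
have cf : ({within `[1 + M^-1, 2 - M^-1], continuous (@Kfun R)})%classic.
  apply: continuous_in_subspaceT => y; rewrite inE /= in_itv /= => yab.
  by apply: Kfun_cont; lra.
have [c cab cmin] := EVT_min ab cf.
move: cab; rewrite in_itv /= => cab.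
exists c; first by lra.
have cM : Kfun c <= M by apply: cmin; rewrite in_itv /=; lra.
move=> y y12.
have [yab|yab] := boolP (y \in `[1 + M^-1, 2 - M^-1]); first exact: cmin.
apply: (le_trans cM).
have Ky := Kfun_ge y12.
have small : (2 - y) * (y - 1) <= M^-1.
  by move: yab; rewrite in_itv /= negb_and -!ltNge => /orP[] ?; nra.
have pos : 0 < (2 - y) * (y - 1) by rewrite mulr_gt0 //; lra.
have K0 : 0 < Kfun y by nra.
have : 1 <= Kfun y * M^-1 by nra.
by rewrite ler_pdivlMr ?mul1r //; lra.
Qed.

Lemma Kstar_is_min (R : realType) :
  (exists2 y : R, 1 < y < 2 & Kstar R = Kfun y) /\
  (forall y : R, 1 < y < 2 -> Kstar R <= Kfun y).
Proof.
have [c c12 cmin] := Kfun_min R.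
suff -> : Kstar R = Kfun c by split=> //; exists c.
apply/eqP; rewrite eq_le; apply/andP; split.
  apply: ge_inf; last by exists c.
  by exists (Kfun c) => _ [y y12 <-]; exact: cmin.
apply: lb_le_inf; first by exists (Kfun c), c.
by move=> _ [y y12 <-]; exact: cmin.
Qed.

(* Main.v *)
(* It suffices that all complex roots w of P_G satisfy |w| <= K* Delta: then every
   factor of |P_G(q-1) P_G(q+1)| = prod |q-1-w| |q+1-w| is at most |q-w|^2, because
   q-1 >= sqrt 2 |w| >= Re w + |Im w|.

   For the root bound, with N contained in W, let R(W, N) be the chromatic polynomial
   of the graph consisting of G[W], the other vertices of G, now isolated, and one more
   vertex joined to N. Deletion-contraction at one of the new edges reads
     z (R(W, N) - R(W, N + v)) = R(W - v, N + N_W(v)),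
   and R(W, 0) = R(W - v, N_W(v)). If t = 1 + y / ((2 - y) |z|), where 1 < y < 2 and
   |z| > Delta y / ((2 - y) ln y), then t^Delta <= y, and induction on |W| yields both
     |R(W, N) - R(W, 0)| <= (t^|N| - 1) |R(W, 0)|  and
     (2 - y) |R(W - v, 0)| <= |R(W, 0)|,
   so that z is not a root of P_G. *)

Require Import Defs.
From mathcomp Require Import all_classical all_reals all_analysis.
From mathcomp Require Import ring lra complex.
(* After all_classical, whose subsetP, setP, etc. would shadow those on {set T}. *)
From mathcomp Require Import all_boot all_order all_algebra.

Set Implicit Arguments.
Unset Strict Implicit.
Unset Printing Implicit Defensive.

Import Order.TTheory GRing.Theory Num.Theory.
Import ComplexField.Normc.

Local Open Scope ring_scope.

(** * Proper colorings and the values of the chromatic polynomial at natural numbers *)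

Definition proper (S C : finType) (adj : rel S) (f : {ffun S -> C}) : bool :=
  [forall x, forall y, adj x y ==> (f x != f y)].

Lemma properP (S C : finType) (adj : rel S) (f : {ffun S -> C}) :
  reflect (forall x y, adj x y -> f x <> f y) (proper adj f).
Proof.
apply: (iffP 'forall_forallP) => h x y.
  by move=> xy; apply/eqP; apply: (implyP (h x y)).
by apply/implyP => /h /eqP.
Qed.

(** A map that is constant along edges is determined by its values at the component representatives
    [roots e], and these values are arbitrary. *)
Lemma card_constant_on_components (S C : finType) (e : rel S) : connect_sym e ->
  #|[set f : {ffun S -> C} | [forall x, forall y, e x y ==> (f x == f y)]]|
    = (#|C| ^ n_comp e predT)%N.
Proof.
move=> sym_e; pose P := [pred x | x \in roots e].
pose rt x : {x | P x} := Sub (fingraph.root e x) (roots_root sym_e x).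
pose F (g : {ffun {x | P x} -> C}) : {ffun S -> C} := [ffun x => g (rt x)].
have F_inj : injective F.
  move=> g1 g2 /ffunP eqg; apply/ffunP => r.
  have rtr : rt (val r) = r by apply: val_inj; rewrite /= (eqP (valP r)).
  by have := eqg (val r); rewrite !ffunE rtr.
have -> : n_comp e predT = #|{: {x | P x}}|.
  by rewrite card_sig; apply: eq_card => x; rewrite !inE andbT.
rewrite -card_ffun -(card_imset _ F_inj); apply: eq_card => f.
rewrite inE; apply/'forall_forallP/imsetP => [fe|[g _ ->] x y].
  have fc x y : connect e x y -> f x = f y.
    case/connectP=> p; elim: p x => [|z p IH] x /=; first by move=> _ ->.
    by move=> /andP[xz zp] ylast; rewrite (eqP (implyP (fe x z) xz)); apply: IH.
  exists [ffun r => f (val r)] => //; apply/ffunP => x.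
  by rewrite !ffunE; apply: fc; apply: connect_root.
apply/implyP => xy; rewrite !ffunE; apply/eqP; congr (g _).
by apply: val_inj => /=; apply/(fingraph.rootP sym_e); apply: connect1.
Qed.

Lemma natr_card_set (R : pzSemiRingType) (X : finType) (P : pred X) :
  #|[set x | P x]|%:R = \sum_x (P x)%:R :> R.
Proof.
rewrite cardsE -sum1_card natr_sum big_mkcond; apply: eq_bigr => x _.
by rewrite unfold_in; case: (P x).
Qed.

(* Whitney: expand the product of [1 - [f u = f v]] over the edges [uv]. *)
Lemma chromatic_poly_nat (S C : finType) (adj : rel S) :
  symmetric adj -> irreflexive adj ->
  (chromatic_poly adj).[#|C|%:Z] = #|[set f : {ffun S -> C} | proper adj f]|%:Z.
Proof.
move=> adj_sym adj_irr.
pose mono (f : {ffun S -> C}) (A : {set S}) :=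
  [forall x in A, forall y in A, f x == f y].
(* The value 0 off the edges lets the product run over all sets [A]; after expansion, every family
   [E] containing a non-edge contributes 0. *)
pose F f (A : {set S}) : int := if A \in edges adj then - (mono f A)%:R else 0.
have monoP f x y : mono f [set x; y] = (f x == f y).
  apply/forall_inP/idP => [/(_ x)|fxy u].
    rewrite !inE eqxx => /(_ isT) /forall_inP /(_ y).
    by rewrite !inE eqxx orbT; apply.
  rewrite !inE => ux; apply/forall_inP => v; rewrite !inE => vy.
  by case/orP: ux => /eqP->; case/orP: vy => /eqP->; rewrite // eq_sym.
have properE f : (proper adj f)%:R = \prod_A (F f A + 1).
  have [/properP fP|fP] := boolP (proper adj f).
    rewrite big1 // => A _; rewrite /F; case: ifPn => [|_]; last by rewrite add0r.
    rewrite inE => /existsP[x /existsP[y /andP[xy /eqP->]]].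
    by rewrite monoP; have /eqP/negPf-> := fP _ _ xy; rewrite oppr0 add0r.
  have [x [y [xy fxy]]] : exists x y, adj x y /\ f x == f y.
    move: fP; rewrite negb_forall => /existsP[x]; rewrite negb_forall => /existsP[y].
    by rewrite negb_imply negbK => /andP[xy fxy]; exists x, y.
  rewrite (bigD1 [set x; y]) //= /F monoP fxy ifT ?addNr ?mul0r //.
  by rewrite inE; apply/existsP; exists x; apply/existsP; exists y; rewrite xy /=.
rewrite -[RHS]natz natr_card_set.
under eq_bigr do rewrite properE bigA_distr.
rewrite exchange_big /= /chromatic_poly horner_sum.
rewrite [RHS](bigID (fun E : {set {set S}} => E \subset edges adj)) /=.
rewrite [X in _ + X]big1 ?addr0; last first.
  move=> E /subsetPn[A AE Aedge]; rewrite big1 // => f _.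
  by rewrite (bigD1 A) //= AE /F (negPf Aedge) mul0r.
apply: eq_big => [E|E]; first by rewrite powersetE.
rewrite powersetE => /subsetP subE; rewrite hornerZ hornerXn.
have FE f : \prod_A (if A \in E then F f A else 1)
    = (-1) ^+ #|E| * [forall x, forall y, spanning_adj E x y ==> (f x == f y)]%:R.
  rewrite -big_mkcond /=; set b := [forall x, _]; have [/forallP fE|fE] := boolP b.
    rewrite mulr1 -prodr_const; apply: eq_bigr => A AE.
    have := subE _ AE; rewrite /F => ->.
    have := subE _ AE; rewrite inE => /existsP[x /existsP[y /andP[xy /eqP eA]]].
    have xyE : spanning_adj E x y by rewrite /spanning_adj /= -eA.
    by rewrite eA monoP (implyP (forallP (fE x) y) xyE).
  move: fE; rewrite negb_forall => /existsP[x]; rewrite negb_forall => /existsP[y].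
  rewrite negb_imply => /andP[]; rewrite /spanning_adj /= => xyE fxy.
  by rewrite mulr0 (bigD1 _ xyE) /= /F subE // monoP (negPf fxy) oppr0 mul0r.
under eq_bigr do rewrite FE.
rewrite -big_distrr /=; congr (_ * _).
have sym_E : connect_sym (spanning_adj E).
  by apply: sym_connect_sym => x y; rewrite /spanning_adj /= setUC.
by rewrite -natr_card_set (card_constant_on_components C sym_E) natrX natz.
Qed.

(** The color of the isolated vertex [a] is free: a coloring amounts to a color for [a] together
    with a coloring in which [a] copies [b]. *)
Lemma card_proper_isolated (S C : finType) (e : rel S) (a b : S) :
  a != b -> (forall x, e a x = false) -> (forall x, e x a = false) ->
  #|[set f : {ffun S -> C} | proper e f]|
    = (#|C| * #|[set f : {ffun S -> C} | proper e f && (f a == f b)]|)%N.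
Proof.
move=> ab ea eb; set D := [set f | _ && _].
pose upd (f : {ffun S -> C}) (c : C) := [ffun x => if x == a then c else f x].
have upd_proper f c : proper e (upd f c) = proper e f.
  apply: eq_forallb => x; apply: eq_forallb => y.
  have [->|xa] := eqVneq x a; first by rewrite ea.
  have [->|ya] := eqVneq y a; first by rewrite eb.
  by rewrite !ffunE (negPf xa) (negPf ya).
rewrite -cardsT -cardsX; pose F (p : C * {ffun S -> C}) := upd p.2 p.1.
have F_inj : {in setX [set: C] D &, injective F}.
  move=> [c f] [c' f']; rewrite !inE /= => /andP[_ /eqP fab] /andP[_ /eqP fab'].
  move=> /ffunP eF; have -> : c = c' by have := eF a; rewrite !ffunE eqxx.
  congr (_, _).
  have eqf x : x != a -> f x = f' x.
    by move=> /negPf xa; have := eF x; rewrite !ffunE xa.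
  apply/ffunP => x; have [->|] := eqVneq x a; last exact: eqf.
  by rewrite fab fab' eqf // eq_sym.
rewrite -(card_in_imset F_inj); apply: eq_card => f; rewrite inE.
apply/idP/imsetP => [fP|[[c g]]]; last first.
  by rewrite !inE /= => /andP[gP _] ->; rewrite upd_proper.
exists (f a, upd f (f b)) => /=.
  by rewrite !inE upd_proper fP !ffunE eqxx (eq_sym b) (negPf ab) /=.
by apply/ffunP => x; rewrite !ffunE; case: eqP => [->|].
Qed.

(** The difference would have more distinct roots than its degree allows. This turns identities
    between coloring counts into identities of polynomials. *)
Lemma eq_poly_nat (p r : {poly int}) :
  (forall n : nat, p.[n.+1%:Z] = r.[n.+1%:Z]) -> p = r.
Proof.
move=> pr; apply/eqP; rewrite -subr_eq0; apply/eqP; set d := p - r.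
apply: (@roots_geq_poly_eq0 _ d [seq n.+1%:Z | n <- iota 0 (size d)]).
- by apply/allP => _ /mapP[n _ ->]; rewrite /root !hornerE pr subrr.
- by rewrite map_inj_uniq ?iota_uniq // => m n [].
- by rewrite size_map size_iota.
Qed.

(** * Deletion-contraction for a graph with one attached vertex *)

Section Attach.
Variables (T : finType) (adj : rel T).
Hypotheses (adj_sym : symmetric adj) (adj_irr : irreflexive adj).
Implicit Types (W N : {set T}) (v : T).

(* The vertices outside W and N are kept, isolated, so that the vertex set does not
   depend on W. *)
Definition attach W N : rel (option T) := fun a b =>
  match a, b with
  | Some x, Some y => [&& adj x y, x \in W & y \in W]
  | Some x, None => x \in N
  | None, Some y => y \in N
  | None, None => false
  end.

(** This is R(W, N), with [None] as the additional vertex. *)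
Definition attach_poly W N : {poly int} := chromatic_poly (attach W N).

Definition nbhd W v := [set x in W | adj v x].

Lemma attach_sym W N : symmetric (attach W N).
Proof. by move=> [x|] [y|] //=; rewrite adj_sym (andbC (x \in W)). Qed.

Lemma attach_irr W N : irreflexive (attach W N).
Proof. by move=> [x|] //=; rewrite adj_irr. Qed.

Lemma attach_poly_nat W N (C : finType) :
  (attach_poly W N).[#|C|%:Z]
    = #|[set f : {ffun option T -> C} | proper (attach W N) f]|%:Z.
Proof. by rewrite chromatic_poly_nat //; [apply: attach_sym|apply: attach_irr]. Qed.

(* If v and None share a color, the neighbors of v can be joined to None instead. *)
Lemma proper_attach_shift (C : finType) W N v (f : {ffun option T -> C}) :
  v \in W -> v \notin N -> f (Some v) = f None ->
  proper (attach W N) f = proper (attach (W :\ v) (N :|: nbhd W v)) f.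
Proof.
move=> vW vN fv; apply/properP/properP => h.
- move=> [x|] [y|] //=; rewrite ?inE.
  + move=> /and3P[xy /andP[_ xW] /andP[_ yW]].
    by apply: (h (Some x) (Some y)); rewrite /= xy xW.
  + case/orP=> [xN|/andP[xW vx]]; first exact: (h (Some x) None).
    by rewrite -fv; apply: (h (Some x) (Some v)); rewrite /= adj_sym vx xW.
  + case/orP=> [yN|/andP[yW vy]]; first exact: (h None (Some y)).
    by rewrite -fv; apply: (h (Some v) (Some y)); rewrite /= vy vW.
- move=> [x|] [y|] //=; last 2 first.
  + by move=> xN; apply: (h (Some x) None); rewrite /= inE xN.
  + by move=> yN; apply: (h None (Some y)); rewrite /= inE yN.
  move=> /and3P[xy xW yW]; have [xv|xv] := eqVneq x v.
    by rewrite xv fv; apply: (h None (Some y)); rewrite /= !inE yW -xv xy orbT.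
  have [yv|yv] := eqVneq y v.
    by rewrite yv fv; apply: (h (Some x) None); rewrite /= !inE xW adj_sym -yv xy orbT.
  by apply: (h (Some x) (Some y)); rewrite /= !inE xy xv xW yv yW.
Qed.

(** On the left [v] is isolated, so it may be made to copy [None] at the cost of a factor [#|C|];
    [proper_attach_shift] then applies. *)
Lemma card_attach_shift (C : finType) W N v :
  v \in W -> N \subset W :\ v ->
  #|[set f : {ffun option T -> C} | proper (attach (W :\ v) (N :|: nbhd W v)) f]|
  = (#|C| * #|[set f : {ffun option T -> C} |
                 proper (attach W N) f && (f (Some v) == f None)]|)%N.
Proof.
move=> vW /subsetP NW; have vN : v \notin N.
  by apply/negP => /NW; rewrite !inE eqxx.
rewrite (@card_proper_isolated _ _ _ (Some v) None) //.
- congr (_ * _)%N; apply: eq_card => f; rewrite !inE.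
  by case: eqP => [fv|]; rewrite ?andbF // -(proper_attach_shift vW vN fv).
- by move=> [x|] /=; rewrite !inE ?eqxx ?andbF // adj_irr (negPf vN) andbF.
- by move=> [x|] /=; rewrite !inE ?eqxx ?andbF // adj_irr (negPf vN) andbF.
Qed.

(** Here [None] is isolated on the left and [v] on the right. Both counts equal [#|C|] times the
    number of colorings of [attach W set0] in which the two agree. *)
Lemma attach_poly_isolated W v : v \in W ->
  attach_poly W set0 = attach_poly (W :\ v) (nbhd W v).
Proof.
move=> vW; apply: eq_poly_nat => n; rewrite -(card_ord n.+1) !attach_poly_nat.
rewrite -[nbhd W v]set0U (card_attach_shift _ vW) ?sub0set //.
rewrite (@card_proper_isolated _ _ _ None (Some v)) //.
- by congr (Posz (_ * _)%N); apply: eq_card => f; rewrite !inE (eq_sym (f None)).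
- by move=> [x|] //=; rewrite inE.
- by move=> [x|] //=; rewrite inE.
Qed.

(* Deletion-contraction for the edge between None and v. *)
Lemma attach_poly_deletion W N v : v \in W -> N \subset W :\ v ->
  'X * (attach_poly W N - attach_poly W (v |: N))
    = attach_poly (W :\ v) (N :|: nbhd W v).
Proof.
move=> vW NW; apply: eq_poly_nat => n; rewrite -(card_ord n.+1) !hornerE.
rewrite !attach_poly_nat (card_attach_shift _ vW NW) PoszM; congr (_ * _).
set A := [set f | proper (attach W N) f].
pose B := [set f : {ffun option T -> 'I_n.+1} | f (Some v) == f None].
(* The new edge excludes exactly the colorings in [B], so the difference of the two counts is the
   size of [A :&: B]. *)
have -> : [set f : {ffun option T -> 'I_n.+1} | proper (attach W (v |: N)) f] = A :\: B.
  apply/setP => f; rewrite !inE; apply/properP/andP => [h|[/eqP fv /properP h]].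
    split; first by apply/eqP/(h (Some v) None); rewrite /= !inE eqxx.
    apply/properP => x y xy; apply: h.
    by move: x y xy => [x|] [y|] //=; rewrite !inE => ->; rewrite orbT.
  move=> [x|] [y|] /=; rewrite ?inE //; first exact: (h (Some x) (Some y)).
    by case/predU1P=> [->//|xN]; apply: (h (Some x) None).
  by case/predU1P=> [-> /esym//|yN]; apply: (h None (Some y)).
have -> : [set f : {ffun option T -> 'I_n.+1} | proper (attach W N) f
    && (f (Some v) == f None)] = A :&: B by apply/setP => f; rewrite !inE.
by rewrite -(cardsID B A) PoszD addrK.
Qed.

Lemma attach_poly0 : attach_poly set0 set0 = 'X ^+ #|T|.+1.
Proof.
apply: eq_poly_nat => n; rewrite -(card_ord n.+1) attach_poly_nat hornerXn.
rewrite -card_option -[X in _ = X ^+ _]natz -natrX natz -card_ffun; congr Posz.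
apply: eq_card => f; rewrite !inE; apply/properP => -[x|] [y|] //=; rewrite ?inE //.
by rewrite !andbF.
Qed.

(** The isolated vertex [None] contributes an independent color, hence the factor ['X]. *)
Lemma attach_polyT : attach_poly setT set0 = 'X * chromatic_poly adj.
Proof.
apply: eq_poly_nat => n; rewrite -(card_ord n.+1) attach_poly_nat !hornerE.
rewrite chromatic_poly_nat // -PoszM; congr Posz.
rewrite -[X in (X * _)%N]cardsT -cardsX; set A := setX _ _.
pose F (p : 'I_n.+1 * {ffun T -> 'I_n.+1}) : {ffun option T -> 'I_n.+1} :=
  [ffun a => if a is Some x then p.2 x else p.1].
have F_inj : injective F.
  move=> [c f] [c' f'] /ffunP eF; have -> : c = c' by have := eF None; rewrite !ffunE.
  by congr (_, _); apply/ffunP => x; have := eF (Some x); rewrite !ffunE.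
rewrite -(card_imset A F_inj); apply: eq_card => f; rewrite inE.
apply/properP/imsetP => [h|[[c g]]].
  exists (f None, [ffun x => f (Some x)]).
    rewrite !inE /=; apply/properP => x y xy; rewrite !ffunE.
    by apply: (h (Some x) (Some y)); rewrite /= xy !inE.
  by apply/ffunP => -[x|]; rewrite !ffunE.
rewrite !inE /= => /properP gP -> [x|] [y|] //=; rewrite ?inE // !ffunE /= andbT.
exact: gP.
Qed.

End Attach.

(** * Complex moduli and the bound on the chromatic roots *)

Lemma normc_ge0 (R : realType) (w : R[i]) : 0 <= normc w.
Proof. by case: w => a b; exact: sqrtr_ge0. Qed.

Lemma normcD (R : realType) (u w : R[i]) : normc (u + w) <= normc u + normc w.
Proof. exact: le_normcD. Qed.

Lemma normcB (R : realType) (u w : R[i]) : normc (u - w) <= normc u + normc w.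
Proof. by have := normcD u (- w); rewrite [normc (- w)]normcN. Qed.

Lemma normc_int (R : realType) (k : int) : normc (k%:~R : R[i]) = `|k%:~R| :> R.
Proof.
have -> : (k%:~R : R[i]) = (k%:~R : R)%:C%C by rewrite rmorph_int.
by rewrite /= expr0n addr0 sqrtr_sqr.
Qed.

Section ZeroFree.
Variables (R : realType) (T : finType) (adj : rel T).
Hypotheses (adj_sym : symmetric adj) (adj_irr : irreflexive adj).
Implicit Types (W N : {set T}) (v : T).

Lemma card_nbhd_le W v : (#|nbhd adj W v| <= max_degree adj)%N.
Proof.
apply: leq_trans (leq_bigmax v); apply: subset_leq_card.
by apply/subsetP => x; rewrite !inE => /andP[].
Qed.

Lemma nbhd_subset W v : nbhd adj W v \subset W :\ v.
Proof.
apply/subsetP => x; rewrite !inE => /andP[-> vx]; rewrite andbT.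
by apply/eqP => xv; move: vx; rewrite xv adj_irr.
Qed.

Variables (y t : R) (z : R[i]).
Hypotheses (y2 : y < 2) (y0 : 0 < y) (t1 : 1 <= t) (z0 : 0 < normc z).
Hypotheses (tz : (t - 1) * ((2 - y) * normc z) = y).
Hypothesis ty : t ^+ max_degree adj <= y.

Let r W N : R[i] := (map_poly intr (attach_poly adj W N)).[z].

Let close W N : Prop :=
  normc (r W N - r W set0) <= (t ^+ #|N| - 1) * normc (r W set0).

Let tX_le W v : t ^+ #|nbhd adj W v| <= y.
Proof. by apply: le_trans ty; rewrite ler_weXn2l // card_nbhd_le. Qed.

(** By [attach_poly_isolated], R(W, 0) = R(W - v, N_W(v)). Closeness and t^Delta <= y put this
    within (y - 1) |R(W - v, 0)| of R(W - v, 0), which leaves at least the fraction 1 - (y - 1) = 2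
    - y. *)
Let remove_vertex W v : v \in W -> (forall N, N \subset W :\ v -> close (W :\ v) N) ->
  (2 - y) * normc (r (W :\ v) set0) <= normc (r W set0).
Proof.
move=> vW cl; rewrite /r (attach_poly_isolated adj_sym adj_irr vW) -!/(r _ _).
have := cl _ (nbhd_subset W v); rewrite /close.
set k := #|_|; have tk : t ^+ k <= y by exact: tX_le.
have := normcB (r (W :\ v) (nbhd adj W v)) (r (W :\ v) (nbhd adj W v) - r (W :\ v) set0).
rewrite opprB addrC subrK.
have := normc_ge0 (r (W :\ v) set0); nra.
Qed.

Let r_deletion W N v : v \in W -> N \subset W :\ v ->
  normc z * normc (r W N - r W (v |: N)) = normc (r (W :\ v) (N :|: nbhd adj W v)).
Proof.
move=> vW NW; rewrite /r -(attach_poly_deletion adj_sym adj_irr vW NW).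
by rewrite -normcM rmorphM rmorphB /= map_polyX hornerM hornerX hornerD hornerN.
Qed.

(** Outer induction on |W|, inner induction on |N|. Detaching one vertex v of N gives M = N - v, and
    the errors add up: (t^|M| - 1) + t^|M| (t - 1) = t^|N| - 1. *)
Lemma attach_poly_close W N : N \subset W -> close W N.
Proof.
have [n] := ubnP #|W|; elim: n => // n IHn in W N *; rewrite ltnS => Wn.
have [m] := ubnP #|N|; elim: m => // m IHm in N *; rewrite ltnS => Nm NW.
have [->|[v vN]] := set_0Vmem N.
  by rewrite /close cards0 expr0 !subrr mul0r normc0.
have t0 : 0 <= t := le_trans ler01 t1.
have vW : v \in W := subsetP NW v vN.
have W'n : (#|W :\ v| < n)%N by apply: leq_trans Wn; rewrite [in leqRHS](cardsD1 v) vW.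
pose M := N :\ v; have MW : M \subset W :\ v by exact: setSD.
have NE : N = v |: M by rewrite setD1K.
have cN : #|N| = #|M|.+1 by rewrite (cardsD1 v) vN.
have clM : close W M.
  by apply: IHm; [rewrite -cN|apply: subset_trans MW _; exact: subD1set].
have shift := r_deletion vW MW.
have rem := remove_vertex vW (fun N => IHn (W :\ v) N W'n).
have sub : M :|: nbhd adj W v \subset W :\ v by rewrite subUset MW nbhd_subset.
have := IHn _ _ W'n sub; rewrite /close; move: shift.
set D := r W M - _; set k := #|_| => shift cl.
have tk : t ^+ k <= t ^+ #|M| * y.
  apply: le_trans (_ : t ^+ (#|M| + #|nbhd adj W v|) <= _).
    by rewrite ler_weXn2l // /k cardsU leq_subr.
  by rewrite exprD ler_wpM2l ?tX_le // exprn_ge0.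
have tri := normcB (r W M - r W set0) D.
have {tri} tri : normc (r W N - r W set0) <= normc (r W M - r W set0) + normc D.
  by have -> : r W N - r W set0 = r W M - r W set0 - D by rewrite NE /D; ring.
have tri2 := normcD (r (W :\ v) (M :|: nbhd adj W v) - r (W :\ v) set0) (r (W :\ v) set0).
rewrite subrK -shift in tri2.
(* By deletion-contraction and closeness for W - v, |z| |D| <= t^|M| y |R(W - v, 0)|. Then [rem]
   replaces R(W - v, 0) by R(W, 0) at the cost of 1 / (2 - y), and [tz] reads y / ((2 - y) |z|) = t
   - 1. *)
have : normc D <= t ^+ #|M| * (t - 1) * normc (r W set0).
  rewrite -(ler_pM2r (mulr_gt0 _ z0 : 0 < (2 - y) * normc z)) ?subr_gt0 //.
  have -> : t ^+ #|M| * (t - 1) * normc (r W set0) * ((2 - y) * normc z)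
      = t ^+ #|M| * y * normc (r W set0) by rewrite -[in RHS]tz; ring.
  apply: le_trans (_ : t ^+ #|M| * y * ((2 - y) * normc (r (W :\ v) set0)) <= _).
    have : normc z * normc D <= t ^+ #|M| * y * normc (r (W :\ v) set0).
      by have := ler_wpM2r (normc_ge0 (r (W :\ v) set0)) tk; lra.
    by rewrite -(ler_pM2l (_ : 0 < 2 - y)) ?subr_gt0 // => h; lra.
  by rewrite ler_wpM2l // mulr_ge0 ?exprn_ge0 // ltW.
by move: clM tri; rewrite /close cN exprS; lra.
Qed.

(** Vertices are removed one at a time, each costing a positive factor 2 - y, down to R(0, 0) =
    z^(|T| + 1). *)
Lemma attach_poly_neq0 W : 0 < normc (r W set0).
Proof.
have [n] := ubnP #|W|; elim: n => // n IHn in W *; rewrite ltnS => Wn.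
have [->|[v vW]] := set_0Vmem W.
  rewrite /r attach_poly0 // rmorphXn /= map_polyX hornerXn.
  by elim: #|T|.+1 => [|k IH]; rewrite ?expr0 ?normc1 // exprS normcM mulr_gt0.
have W'n : (#|W :\ v| < n)%N by apply: leq_trans Wn; rewrite [in leqRHS](cardsD1 v) vW.
apply: lt_le_trans (remove_vertex vW (fun N => @attach_poly_close (W :\ v) N)).
by rewrite mulr_gt0 ?subr_gt0 ?IHn.
Qed.

Lemma chromatic_poly_neq0 : ~~ root (map_poly intr (chromatic_poly adj)) z.
Proof.
apply/negP => /eqP pz; have := attach_poly_neq0 setT.
by rewrite /r attach_polyT // rmorphM hornerM pz mulr0 normc0 ltxx.
Qed.

End ZeroFree.
Lemma chromatic_poly_root_le (R : realType) (T : finType) (adj : rel T)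
    (y : R) (z : R[i]) :
  symmetric adj -> irreflexive adj -> 1 < y < 2 ->
  root (map_poly intr (chromatic_poly adj)) z ->
  normc z <= Kfun y * (max_degree adj)%:R.
Proof.
move=> adj_sym adj_irr y12 rz; move: (y12) => /andP[y1 y2].
rewrite leNgt; apply/negP => zK; move: rz; apply/negP.
have ly : 0 < ln y by rewrite ln_gt0.
have p2 : 0 < 2 - y by rewrite subr_gt0.
have z0 : 0 < normc z.
  apply: le_lt_trans zK; rewrite mulr_ge0 // /Kfun divr_ge0 ?mulr_ge0 //; lra.
have p : 0 < (2 - y) * normc z by rewrite mulr_gt0.
pose x := y / ((2 - y) * normc z).
have x0 : 0 <= x by rewrite divr_ge0 //; lra.
apply: (@chromatic_poly_neq0 R T adj adj_sym adj_irr y (1 + x)) => //; try lra.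
  by rewrite addrC addKr /x divfK // gt_eqF.
(* Since 1 + x <= exp x, the condition t^Delta <= y follows from x Delta <= ln y, which is the
   assumed lower bound on |z| rearranged. *)
apply: le_trans (_ : expR x ^+ max_degree adj <= _).
  by rewrite lerXn2r ?nnegrE ?expR_ge0 ?expR_ge1Dx //; lra.
rewrite -expRM_natl -[leRHS]lnK ?posrE ?ler_expR; last lra.
rewrite /x mulrA ler_pdivrMr //.
move: zK => /ltW; rewrite /Kfun mulrAC ler_pdivrMr ?mulr_gt0 //.
by move=> h; lra.
Qed.

(** * From the root bound to log-concavity *)

(** With u = s + 1 - a, the left side equals (u^2 + b^2 + 1)^2 - 4 u^2, so the claim amounts to 2
    b^2 + 1 <= 2 u^2. This follows from u >= 1 + |b|. *)
Lemma shifted_sqr_le (R : realFieldType) (r s a b : R) :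
  0 <= r -> a ^+ 2 + b ^+ 2 <= r ^+ 2 -> 2 * r ^+ 2 <= s ^+ 2 -> 0 <= s ->
  ((s - a) ^+ 2 + b ^+ 2) * ((s + 2 - a) ^+ 2 + b ^+ 2)
    <= ((s + 1 - a) ^+ 2 + b ^+ 2) ^+ 2.
Proof.
move=> r0 ab rs s0; have b0 := normr_ge0 b; have b2 : `|b| ^+ 2 = b ^+ 2.
  by rewrite real_normK ?num_real.
have sab : a + `|b| <= s.
  (* Otherwise s^2 < (a + |b|)^2 <= 2 (a^2 + b^2) <= 2 r^2, against the hypothesis on s. *)
  rewrite leNgt; apply/negP => h.
  have : s ^+ 2 < (a + `|b|) ^+ 2 by rewrite ltrXn2r // ?nnegrE //; lra.
  have := sqr_ge0 (a - `|b|); nra.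
set u := s + 1 - a; have ub : (1 + `|b|) ^+ 2 <= u ^+ 2.
  by rewrite lerXn2r ?nnegrE /u //; lra.
have -> : s - a = u - 1 by rewrite /u; ring.
have -> : s + 2 - a = u + 1 by rewrite /u; ring.
have : b ^+ 2 + 1 <= u ^+ 2 by nra.
nra.
Qed.

Lemma normc_shift_le (R : realType) (K q : R) (w : R[i]) :
  0 <= K -> normc w <= K -> Num.sqrt 2 * K + 1 <= q ->
  normc ((q - 1)%:C - w)%C * normc ((q + 1)%:C - w)%C <= normc (q%:C - w)%C ^+ 2.
Proof.
move=> K0; case: w => a b; rewrite /= !add0r !sqrrN => wK qK.
have s0 : 0 <= (Num.sqrt 2 : R) := sqrtr_ge0 _.
have s2 : (Num.sqrt 2 : R) ^+ 2 = 2 by rewrite sqr_sqrtr.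
have abK : a ^+ 2 + b ^+ 2 <= K ^+ 2.
  by rewrite -[leLHS]sqr_sqrtr ?addr_ge0 ?sqr_ge0 // lerXn2r // nnegrE sqrtr_ge0.
rewrite -sqrtrM ?addr_ge0 ?sqr_ge0 // sqr_sqrtr ?addr_ge0 ?sqr_ge0 //.
rewrite -[leRHS]ger0_norm ?addr_ge0 ?sqr_ge0 // -sqrtr_sqr ler_wsqrtr //.
have K2 : 0 <= Num.sqrt 2 * K by rewrite mulr_ge0.
have := @shifted_sqr_le R K (q - 1) a b K0 abK.
have -> : q - 1 + 2 = q + 1 by ring.
rewrite subrK; apply; last lra.
have -> : 2 * K ^+ 2 = (Num.sqrt 2 * K) ^+ 2 by rewrite exprMn s2.
by rewrite lerXn2r ?nnegrE //; lra.
Qed.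

Theorem theorem3 (R : realType) (T : finType) (adj : rel T)
    (adj_sym : symmetric adj) (adj_irr : irreflexive adj) (q : int) :
  (Num.sqrt 2 * Kstar R) * (max_degree adj)%:R + 1 <= q%:~R ->
  (chromatic_poly adj).[q - 1] * (chromatic_poly adj).[q + 1]
    <= (chromatic_poly adj).[q] ^+ 2.
Proof.
move=> qK; set P := chromatic_poly adj; pose K := Kstar R * (max_degree adj)%:R.
(* Taking [y] to be the minimizer gives the root bound with the constant [Kstar R] itself, without a
   limit. *)
have [y y12 KE] := (Kstar_is_min R).1.
have roots_le w : root (map_poly intr P) w -> normc w <= K.
  by rewrite /K KE; exact: chromatic_poly_root_le.
have K0 : 0 <= K.
  rewrite mulr_ge0 // KE /Kfun divr_ge0 ?mulr_ge0 ?ln_ge0 //; lra.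
have {}qK : Num.sqrt 2 * K + 1 <= q%:~R by rewrite /K mulrA.
rewrite -(ler_int R) [leRHS]rmorphXn /=.
(* The right side is a square, so it suffices to compare absolute values, which are then computed as
   moduli in [R[i]], where the polynomial splits. *)
rewrite -[leRHS]ger0_norm ?sqr_ge0 // normrX (le_trans (ler_norm _)) //.
rewrite -!normc_int rmorphM normcM /= -!(horner_map intr) /=.
have [s PE] := closed_field_poly_normal (map_poly intr P : {poly R[i]}).
(* A nonzero leading coefficient ensures that the members of [s] are roots, so that [roots_le]
   applies to them. *)
have [c0|cn0] := eqVneq (lead_coef (map_poly intr P : {poly R[i]})) 0.
  by rewrite PE c0 scale0r !horner0 normc0 mul0r expr0n.
rewrite PE !hornerZ !normcM exprMn mulrACA -expr2 ler_wpM2l ?sqr_ge0 //.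
have : {in s, forall w, normc w <= K}.
  by move=> w ws; apply: roots_le; rewrite PE rootZ // root_prod_XsubC; exact: ws.
elim: s {PE} => [|w s IH] sK; first by rewrite !big_nil !hornerC normc1 mul1r expr1n.
rewrite !big_cons !hornerM !hornerXsubC !normcM exprMn mulrACA.
rewrite ler_pM ?mulr_ge0 ?normc_ge0 //; last first.
  by apply: IH => u us; apply: sK; rewrite inE us orbT.
have := normc_shift_le K0 (sK w (mem_head _ _)) qK.
by rewrite !(rmorphB, rmorphD, rmorph1, rmorph_int); exact: id.
Qed.
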